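(* Consider the linear Gaussian policy-augmented knowledge graph (pKG) model defined in the context, with policy parameters $\pmb\theta$ fixed. Let $o=e_h^k$ be the $k$-th component of the residual $\pmb e_h$ ($1\le k\le n$, $1\le h\le H$), with given value $e_h^k$, and let $\mathrm{1}_k\in\mathbb{R}^n$ be the $k$-th standard basis column vector. For the predictive (expectation-based) sensitivity analysis, the Shapley value of $o$ is, for every $0\le t\le H-1$, $$\mathrm{Sh}\left(\pmb s_{t+1}\mid o;\pmb\theta\right)=\mathbb{E}_{\pmb w}\left\{\mathbf R_{h,t}\,e_h^k\,\mathrm{1}_k\right\},$$ and for the cumulative reward $$\mathrm{Sh}\left(\sum_{t=0}^{H-1}r_{t+1}\,\Big|\,o;\pmb\theta\right)=\mathbb{E}_{\pmb w}\left\{\sum_{t=0}^{H-1}\left(\pmb b_{t+1}^\top\pmb\theta_{t+1}^\top+\pmb c_{t+1}^\top\right)\mathbf R_{h,t}\,e_h^k\,\mathrm{1}_k\right\}.$$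
   Context: Linear Gaussian pKG model. Integers $n,m,H\ge1$. States $\pmb s_t\in\mathbb{R}^n$, actions $\pmb a_t\in\mathbb{R}^m$, $t=1,\dots,H$. The initial state is $\pmb s_1=\pmb s_0+\pmb e_1$ with $\pmb s_0\in\mathbb{R}^n$ a fixed vector. For $1\le t\le H-1$, $$\pmb s_{t+1}=\pmb\mu^s_{t+1}+(\pmb\beta^s_t)^\top(\pmb s_t-\pmb\mu^s_t)+(\pmb\beta^a_t)^\top(\pmb a_t-\pmb\mu^a_t)+\pmb e_{t+1},$$ with $\pmb\mu^s_t\in\mathbb{R}^n$, $\pmb\mu^a_t\in\mathbb{R}^m$ fixed, $\pmb\beta^s_t\in\mathbb{R}^{n\times n}$, $\pmb\beta^a_t\in\mathbb{R}^{m\times n}$. The policy is linear: $\pmb a_t=\pmb\mu^a_t+\pmb\theta_t^\top(\pmb s_t-\pmb\mu^s_t)$ with $\pmb\theta_t\in\mathbb{R}^{n\times m}$, $1\le t\le H$. The reward is $r_t=m_t+\pmb b_t^\top\pmb a_t+\pmb c_t^\top\pmb s_t$ with $m_t\in\mathbb{R}$, $\pmb b_t\in\mathbb{R}^m$, $\pmb c_t\in\mathbb{R}^n$. Given the model parameters $\pmb w$ (the entries of all $\pmb\beta^s_t,\pmb\beta^a_t$ and the covariance matrix of $\pmb e$), the residual vector $\pmb e=(\pmb e_1,\dots,\pmb e_H)$ is a multivariate Gaussian with mean zero. The parameters $\pmb w$ are themselves random with a given (posterior) distribution $p(\pmb w\mid\mathcal D)$, and $\mathbb{E}_{\pmb w}$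 is expectation with respect to it (assumed to exist). Pathway coefficients: for $i\le t$, $\mathbf R_{i,t}=M_tM_{t-1}\cdots M_i$ with $M_j=(\pmb\beta^s_j)^\top+(\pmb\beta^a_j)^\top\pmb\theta_j^\top$; $\mathbf R_{i,i-1}=\mathbf I$; $\mathbf R_{i,t}=\mathbf 0$ if $t<i-1$. Predictive Shapley value. The input set is $\mathcal O=\{e_t^k:1\le k\le n,1\le t\le H\}$ (scalar random factors), each having a given value. For an output $Y$ (a state vector, componentwise, or the cumulative reward), and $\mathcal U\subset\mathcal O$, the value function is $g(\mathcal U\mid\pmb w)=\mathbb{E}[Y\mid\mathcal U;\pmb w]$, the expected output when the inputs in $\mathcal U$ are set (fixed) to their given values while the remaining random factors are drawn from their (unconditional, joint marginal) distribution. For $o\in\mathcal O$, $$\mathrm{Sh}(Y\mid o,\pmb\theta;\pmb w)=\sum_{\mathcal U\subset\mathcal O\setminus\{o\}}\frac{(|\mathcal O|-|\mathcal U|-1)!\,|\mathcal U|!}{|\mathcal O|!}\left[g(\mathcal U\cup\{o\}\mid\pmb w)-g(\mathcal U\mid\pmb w)\right],$$ and $\mathrm{Sh}(Y\mid o;\pmb\theta)=\mathbb{E}_{\pmb w}[\mathrm{Sh}(Y\mid o,\pmb\theta;\pmb w)]$. *)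

(* Defs.v *)
From HB Require Import structures.
From mathcomp Require Import all_boot all_order all_algebra.
From mathcomp Require Import all_classical all_reals all_analysis.

Set Implicit Arguments.
Unset Strict Implicit.
Unset Printing Implicit Defensive.

Import Order.TTheory GRing.Theory Num.Theory.

Local Open Scope ring_scope.

(* The law N(0, v), for a variance v >= 0. The degenerate case has to be
   separated: the library's [normal_prob m 0] is the uniform law on [0, 1]. *)
Definition centered_normal (R : realType) (v : R) (A : set R) : \bar R :=
  if v == 0 then dirac (0 : R) A else normal_prob 0 (Num.sqrt v) A.

(* X is multivariate Gaussian with mean zero and (possibly singular) covariance
   matrix V: every linear combination \sum_i c_i X_i has law N(0, c^T V c). *)
Definition centered_gaussian_vector (R : realType) d (E : measurableType d)
    (P : probability E R) (I : finType) (X : E -> I -> R) (V : I -> I -> R) :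
    Prop :=
  [/\ forall i, measurable_fun [set: E] (fun x => X x i),
      forall i j, V i j = V j i &
      forall c : I -> R, let v := \sum_i \sum_j c i * V i j * c j in
        0 <= v /\
        forall A : set R, measurable A ->
          pushforward P (fun x => \sum_i c i * X x i) A = centered_normal v A].

Definition shapley (R : realType) (O : finType) (g : {set O} -> R) (o : O) : R :=
  \sum_(U : {set O} | o \notin U)
    ((#|O| - #|U| - 1)`! * #|U| `!)%:R / (#|O| `!)%:R * (g (o |: U)%SET - g U).

(* The families indexed by nat, here and in [params], are indexed by the time
   t = 1, ..., H; their values at other indices are irrelevant. *)
Record pkg (R : realType) (n m : nat) := Pkg {
  s0 : 'cV[R]_n;
  mu_s : nat -> 'cV[R]_n;
  mu_a : nat -> 'cV[R]_m;
  rew_m : nat -> R;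
  rew_b : nat -> 'cV[R]_m;
  rew_c : nat -> 'cV[R]_n }.

(* The scalar random factors; (i, k) : resid_idx H n stands for e_{i+1}^{k+1}. *)
Definition resid_idx (H n : nat) : finType := ('I_H * 'I_n)%type.

(* The model parameters w. *)
Record params (R : realType) (n m H : nat) := Params {
  beta_s : nat -> 'M[R]_n;
  beta_a : nat -> 'M[R]_(m, n);
  cov_e : resid_idx H n -> resid_idx H n -> R }.

Definition measurable_params (R : realType) (n m H : nat) d
    (W : measurableType d) (w : W -> params R n m H) : Prop :=
  [/\ forall t i j, (1 <= t < H)%N ->
        measurable_fun [set: W] (fun x => beta_s (w x) t i j),
      forall t i j, (1 <= t < H)%N ->
        measurable_fun [set: W] (fun x => beta_a (w x) t i j) &
      forall o o', measurable_fun [set: W] (fun x => cov_e (w x) o o')].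

Section Model.
Variables (R : realType) (n m H : nat).
Variables (G : pkg R n m) (theta : nat -> 'M[R]_(n, m)).

(* e_t for 1 <= t <= H; the values at other t are irrelevant. *)
Definition resid (e : resid_idx H n -> R) (t : nat) : 'cV[R]_n :=
  \col_k (if insub t.-1 is Some i then e (i, k) else 0).

Definition policy (t : nat) (s : 'cV[R]_n) : 'cV[R]_m :=
  mu_a G t + (theta t)^T *m (s - mu_s G t).

(* s_t for 1 <= t <= H; at t = 0 this is the fixed vector s_0. *)
Fixpoint state (w : params R n m H) (e : resid_idx H n -> R) (t : nat) : 'cV[R]_n :=
  match t with
  | 0 => s0 G
  | t'.+1 =>
    let s := state w e t' in
    if t' == 0%N then s + resid e 1
    else mu_s G t'.+1 + (beta_s w t')^T *m (s - mu_s G t')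
         + (beta_a w t')^T *m (policy t' s - mu_a G t') + resid e t'.+1
  end.

Definition state_comp (t : nat) (i : 'I_n) (w : params R n m H)
    (e : resid_idx H n -> R) : R := state w e t i 0.

Definition action (w : params R n m H) (e : resid_idx H n -> R) (t : nat) :
    'cV[R]_m := policy t (state w e t).

Definition reward (w : params R n m H) (e : resid_idx H n -> R) (t : nat) : R :=
  rew_m G t + ((rew_b G t)^T *m action w e t) 0 0
            + ((rew_c G t)^T *m state w e t) 0 0.

Definition cum_reward (w : params R n m H) (e : resid_idx H n -> R) : R :=
  \sum_(0 <= t < H) reward w e t.+1.

Definition step_mx (w : params R n m H) (j : nat) : 'M[R]_n :=
  (beta_s w j)^T + (beta_a w j)^T *m (theta j)^T.

(* R_{i,t} = M_t M_{t-1} ... M_i; the product is empty when t = i - 1. *)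
Definition pathway (w : params R n m H) (i t : nat) : 'M[R]_n :=
  if (t.+1 < i)%N then 0
  else \big[mulmx/1%:M]_(j <- rev (index_iota i t.+1)) step_mx w j.

End Model.

Section PredictiveShapley.
Variables (R : realType) (n m H : nat).
Variables (dW dE : measure_display).
Variables (W : measurableType dW) (p : probability W R).
Variable w : W -> params R n m H.
Variables (E : measurableType dE) (P : W -> probability E R).
Variable e : E -> resid_idx H n -> R.
Variable given : resid_idx H n -> R.
Variable Y : params R n m H -> (resid_idx H n -> R) -> R.

Definition set_inputs (U : {set resid_idx H n}) (x : resid_idx H n -> R) :
    resid_idx H n -> R :=
  fun o => if o \in U then given o else x o.

(* g(U | w): the factors outside U keep their unconditional joint law given w;
   they are not conditioned on the values of those in U. *)
Definition value_fun (x : W) (U : {set resid_idx H n}) : R :=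
  fine ('E_(P x)[fun y => Y (w x) (set_inputs U (e y))])%E.

Definition Sh_given (o : resid_idx H n) (x : W) : R := shapley (value_fun x) o.

Definition Sh (o : resid_idx H n) : \bar R := ('E_p[Sh_given o])%E.

End PredictiveShapley.

Definition expectation_vec (R : realType) d (W : measurableType d)
    (p : probability W R) (n : nat) (X : W -> 'cV[R]_n) : 'cV[\bar R]_n :=
  \col_i ('E_p[fun x => X x i ord0])%E.

(* Main.v *)
(* Unrolling the recursion, every state s_{t+1}, hence every reward, is an affine
   function of the residuals in which e_h^k has coefficient R_{h,t} 1_k. A linear
   combination of the residuals left random is a centered Gaussian, so it has
   mean zero, and g(U | w) is a constant plus the sum over U of the given
   contributions. For such an additive game the Shapley value of a player is its
   own contribution, because the Shapley weights sum to one. *)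
Require Import Defs.
From HB Require Import structures.
From mathcomp Require Import all_boot all_order all_algebra.
From mathcomp Require Import all_classical all_reals all_analysis.
From mathcomp Require Import measurable_realfun ring lra.

Set Implicit Arguments.
Unset Strict Implicit.
Unset Printing Implicit Defensive.

Import Order.TTheory GRing.Theory Num.Theory.

Local Open Scope ring_scope.

(** * Shapley values of additive games *)

Section Shapley.
Variables (R : realType) (O : finType).

(** Group the subsets by size: those of size [j] that avoid [o] are the [j]-subsets of the
    complement of [o]. *)
Lemma sum_card_subsets_avoiding (F : nat -> R) (o : O) :
  \sum_(U : {set O} | o \notin U) F #|U| =
  \sum_(j < #|O|) F j *+ 'C(#|O|.-1, j).
Proof.
have cardO : #|~: [set o]| = #|O|.-1 by rewrite cardsC1.
have ltU (U : {set O}) : o \notin U -> (#|U| < #|O|)%N.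
  move=> oU; rewrite -cardsT; apply: proper_card; rewrite properT.
  by apply: contra oU => /eqP ->; rewrite inE.
have O_gt0 : (0 < #|O|)%N by apply/card_gt0P; exists o.
(* The default [Ordinal O_gt0] is never reached, by [ltU]. *)
rewrite (partition_big (fun U : {set O} => insubd (Ordinal O_gt0) #|U|) xpredT)//=.
apply: eq_bigr => j _.
rewrite (eq_bigr (fun=> F j)); last first.
  by move=> U /andP[oU /eqP <-]; rewrite val_insubd ltU.
rewrite sumr_const -cardO -cards_draws; congr (_ *+ _).
apply: eq_card => U; rewrite !inE finset.subsetC finset.sub1set inE unfold_in.
by case: (boolP (o \in U)) => //= oU; rewrite -val_eqE val_insubd ltU.
Qed.

Lemma shapley_additive (b : R) (a : O -> R) (g : {set O} -> R) (o : O) :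
  (forall U, g U = b + \sum_(i in U) a i) -> shapley g o = a o.
Proof.
move=> gE; rewrite /shapley.
have O_gt0 : (0 < #|O|)%N by apply/card_gt0P; exists o.
pose F j : R := ((#|O| - j - 1)`! * j `!)%:R / (#|O| `!)%:R.
transitivity ((\sum_(U : {set O} | o \notin U) F #|U|) * a o).
  rewrite mulr_suml; apply: eq_bigr => U oU; congr (_ * _).
  by rewrite !gE big_setU1//= addrCA [b + _]addrC addrK.
(* Each size [j] carries total weight 1/|O|, because (|O|-1-j)! j! C(|O|-1, j) = (|O|-1)!. *)
rewrite sum_card_subsets_avoiding (eq_bigr (fun=> (#|O|%:R)^-1)).
  by rewrite sumr_const card_ord -[_ *+ _]mulr_natr mulVf ?mul1r// pnatr_eq0 -lt0n.
move=> j _; rewrite -[F j *+ _]mulr_natr /F mulrAC -natrM mulnC.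
have le_j : (j <= #|O|.-1)%N by rewrite -ltnS prednK.
rewrite -subnDA addnC subnDA subn1 [(_`! * _)%N]mulnC bin_fact//.
rewrite -[in (#|O|)`!](prednK O_gt0) factS natrM invfM mulrCA prednK//.
by rewrite mulfV ?mulr1// pnatr_eq0 -lt0n fact_gt0.
Qed.

End Shapley.

(** * First moments of centered Gaussian combinations *)

Section Gaussian.
Variable R : realType.
Local Notation mu := (@lebesgue_measure R).

(* As exp u >= 1 + u, the factor |x| is absorbed by doubling the standard
   deviation, which reduces the first moment to the total mass. *)
Lemma abs_normal_pdf_le (s x : R) : s != 0 ->
  `|x| * normal_pdf 0 s x <= (2 * (1 + s ^+ 2 *+ 4)) * normal_pdf 0 (2 * s) x.
Proof.
move=> s0.
have s2_gt0 : 0 < s ^+ 2 by rewrite exprn_even_gt0.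
rewrite !normal_pdfE ?mulf_neq0 ?pnatr_eq0// /normal_fun subr0.
have -> : normal_peak (2 * s) = 2^-1 * normal_peak s.
  rewrite /normal_peak exprMn -!mulrnAr -mulrA sqrtrM ?exprn_ge0// sqrtr_sqr.
  by rewrite invfM gtr0_norm.
set E := expR (_ / ((2 * s) ^+ 2 *+ 2)).
(* [u] is the gap between the exponents x^2/(2 s^2) and x^2/(8 s^2). *)
pose u := x ^+ 2 / (s ^+ 2 *+ 8) *+ 3.
have -> : expR (- x ^+ 2 / (s ^+ 2 *+ 2)) = E * expR (- u).
  by rewrite -expRD; congr expR; rewrite /u; field.
have u_ge0 : 0 <= u by rewrite mulrn_wge0// divr_ge0 ?sqr_ge0// mulrn_wge0// ltW.
have xle : `|x| <= (1 + s ^+ 2 *+ 4) * expR u.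
  apply: (@le_trans _ _ ((1 + s ^+ 2 *+ 4) * (1 + u))); last first.
    by rewrite ler_pM2l ?expR_ge1Dx// addr_gt0// pmulrn_lgt0.
  (* The constant 4 s^2 turns [u] into 3 x^2/2, free of [s]; then (|x| - 1)^2 >= 0 suffices. *)
  have -> : (1 + s ^+ 2 *+ 4) * (1 + u) =
      1 + s ^+ 2 *+ 4 + u + x ^+ 2 *+ 3 / 2.
    by rewrite /u; field.
  rewrite -(real_normK (num_real x)).
  have := sqr_ge0 (`|x| - 1); have := ltW s2_gt0; nra.
have E_ge0 : 0 <= normal_peak s * E by rewrite mulr_ge0 ?normal_peak_ge0 ?expR_ge0.
rewrite [leRHS](_ : _ = normal_peak s * E * (1 + s ^+ 2 *+ 4)); last by field.
rewrite [leLHS](_ : _ = normal_peak s * E * (`|x| * expR (- u))); last by ring.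
by apply: ler_wpM2l; rewrite // expRN ler_pdivrMr ?expR_gt0.
Qed.

Lemma normal_prob_abs_lty (s : R) : s != 0 ->
  (\int[normal_prob 0 s]_x `|x|%:E < +oo)%E.
Proof.
move=> s0.
pose f := Radon_Nikodym_SigmaFinite.f (normal_prob (0 : R) s) mu.
have dom := normal_prob_dominates (0 : R) s.
(* Both functions have the same integral over every measurable set, so the abstract derivative may
   be replaced by the explicit density. *)
have fE : ae_eq mu setT f (fun x => (normal_pdf 0 s x)%:E).
  apply: integral_ae_eq => //.
  - exact: Radon_Nikodym_SigmaFinite.f_integrable.
  - by apply/measurable_EFinP; exact: measurable_normal_pdf.
  - by move=> A _ mA; rewrite -Radon_Nikodym_SigmaFinite.f_integral.
have mabs : measurable_fun setT (fun x : R => `|x|%:E).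
  by apply/measurable_EFinP; exact: normr_measurable.
have mpdf t : measurable_fun setT (fun x : R => (normal_pdf 0 t x)%:E).
  by apply/measurable_EFinP; exact: measurable_normal_pdf.
have -> : (\int[normal_prob 0%R s]_x `|x|%:E =
    \int[mu]_x (`|x|%:E * (normal_pdf 0 s x)%:E))%E.
  rewrite -(Radon_Nikodym_SigmaFinite.change_of_variables dom)//.
  apply: ae_eq_integral => //.
  - apply: emeasurable_funM => //.
    exact: measurable_int (Radon_Nikodym_SigmaFinite.f_integrable dom).
  - exact: (emeasurable_funM mabs (mpdf s)).
  - exact: ae_eqe_mul2l.
pose C := 2 * (1 + s ^+ 2 *+ 4).
have C_ge0 : 0 <= C by rewrite mulr_ge0// addr_ge0// mulrn_wge0// sqr_ge0.
apply: (@le_lt_trans _ _ (\int[mu]_x (C%:E * (normal_pdf 0 (2 * s) x)%:E))%E).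
  apply: ge0_le_integral => //.
  - by move=> x _; rewrite -EFinM lee_fin mulr_ge0 ?normal_pdf_ge0.
  - exact: (emeasurable_funM mabs (mpdf s)).
  - exact: (measurable_funeM _ (mpdf (2 * s))).
  - by move=> x _; rewrite -!EFinM lee_fin abs_normal_pdf_le.
rewrite ge0_integralZl//; last 2 first.
- exact: mpdf.
- by move=> x _; rewrite lee_fin normal_pdf_ge0.
by rewrite integral_normal_pdf mule1 ltry.
Qed.

Lemma centered_normal_law_abs_lty
    (m : {measure set (measurableTypeR R) -> \bar R}) (v : R) :
  (forall A, measurable A -> m A = centered_normal v A) -> 0 <= v ->
  (\int[m]_x `|x|%:E < +oo)%E.
Proof.
move=> mE v_ge0; rewrite /centered_normal in mE.
case: eqVneq mE => [_|v0] mE.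
  rewrite (eq_measure_integral (dirac (0 : measurableTypeR R))) => [|A mA _];
    last exact: mE.
  rewrite integral_dirac//; first by rewrite normr0 mule0 ltry.
  by apply/measurable_EFinP; exact: normr_measurable.
rewrite (eq_measure_integral (normal_prob 0 (Num.sqrt v))) => [|A mA _];
  last exact: mE.
by apply: normal_prob_abs_lty; rewrite sqrtr_eq0 -ltNge lt0r v0.
Qed.

(** The mean vanishes by symmetry: the combination and its opposite have the same law, so a finite
    mean equals its own opposite. *)
Lemma gaussian_combination_expectation d (E : measurableType d)
    (P : probability E R) (I : finType) (X : E -> I -> R) (V : I -> I -> R)
    (c : I -> R) : centered_gaussian_vector P X V ->
  P.-integrable setT (EFin \o (fun x => (\sum_i c i * X x i)%R)) /\
  ('E_P[fun x => (\sum_i c i * X x i)%R] = 0)%E.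
Proof.
case=> mX _ lawX.
pose L (c : I -> R) x := \sum_i c i * X x i.
have mL b : measurable_fun setT (L b).
  by apply: measurable_sum => i; apply: measurable_funM.
have [v_ge0 lawL] := lawX c.
have [_ lawN] := lawX (fun i => - c i).
set v := \sum_i \sum_j _ in v_ge0 lawL.
have vN : \sum_i \sum_j - c i * V i j * - c j = v.
  by apply: eq_bigr => i _; apply: eq_bigr => j _; rewrite mulrN !mulNr opprK.
rewrite vN in lawN.
have LN x : L (fun i => - c i) x = - L c x.
  by rewrite /L -sumrN; apply: eq_bigr => i _; rewrite mulNr.
(* The density of [normal_prob] is taken on [measurableTypeR R]; its display
   differs from that of the default instance on [R]. *)
pose Lm b : {mfun E >-> measurableTypeR R} :=
  HB.pack (L b) (isMeasurableFun.Build _ _ _ (measurableTypeR R) (L b) (mL b)).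
(* Integrability is read off the law, through the image measure on the real line. *)
have intL b :
    (forall A, measurable A -> distribution P (Lm b) A = centered_normal v A) ->
    P.-integrable setT (EFin \o L b).
  move=> law; apply/integrableP; split; first exact/measurable_EFinP.
  have := centered_normal_law_abs_lty law v_ge0.
  rewrite ge0_integral_distribution//.
  by apply/measurable_EFinP; exact: normr_measurable.
have iL := intL _ lawL; have iLN := intL _ lawN.
split=> //; rewrite unlock.
(* L and - L have the same variance, hence the same law. *)
have sym : (\int[P]_x (L c x)%:E = \int[P]_x (L (fun i => (- c i)%R) x)%:E)%E.
  rewrite -[LHS](@integral_distribution _ _ _ _ _ P (Lm c) EFin)//.
  rewrite -[RHS](@integral_distribution _ _ _ _ _ P (Lm (fun i => - c i)) EFin)//.
  by apply: eq_measure_integral => A mA _; rewrite /= [LHS]lawL// [RHS]lawN.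
have fin := integrable_fin_num measurableT iL.
move: sym; under [RHS]eq_integral do rewrite LN EFinN.
rewrite integralN/=; last exact: integrable_add_def.
move: fin; rewrite /comp /L; case: (\int[P]_x _)%E => // r _ [/eqP].
by rewrite -addr_eq0 -mulr2n mulrn_eq0/= => /eqP ->.
Qed.

End Gaussian.

(** * Affine dependence of states and rewards on the residuals *)

Section LinearModel.
Variables (R : realType) (n m H : nat).
Variables (G : pkg R n m) (theta : nat -> 'M[R]_(n, m)).
Implicit Types (w : params R n m H) (z : resid_idx H n -> R).

(** The sum runs over all factors, not only those of one time, so that it merges termwise with the
    sum of propagated effects in [state_affine]. *)
Lemma residE z t : (t < H)%N ->
  resid z t.+1 = \sum_(o : resid_idx H n)
    (if o.1 == t :> nat then z o else 0) *: delta_mx o.2 0.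
Proof.
move=> tH; apply/colP => k; rewrite mxE /= insubT summxE.
rewrite (bigD1 (Ordinal tH, k))//= big1 ?addr0; last first.
  case=> i l /= ilN; rewrite !mxE eqxx andbT.
  case: eqP => [it|_]; last by rewrite mul0r.
  case: eqP => [kl|_]; last by rewrite mulr0.
  by case/eqP: ilN; congr pair; [exact: val_inj|].
by rewrite !mxE !eqxx mulr1.
Qed.

(** The Kronecker term accounts for the empty product: at [i = t.+1] the pathway passes from zero to
    the identity, as a fresh residual enters. *)
Lemma pathwayS w i t : pathway theta w i.+1 t.+1 =
  step_mx theta w t.+1 *m pathway theta w i.+1 t + (i == t.+1)%:R%:M.
Proof.
rewrite /pathway !ltnS; case: (ltngtP i t.+1) => [it|it|->].
- rewrite raddf0 addr0 /index_iota.
  have -> : (t.+2 - i.+1 = (t.+1 - i.+1) + 1)%N by rewrite addn1 !subSS subSn.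
  rewrite iotaD rev_cat /= big_cons; congr (step_mx _ _ _ *m _).
  by rewrite subSS addSn subnKC.
- by rewrite mulmx0 add0r raddf0.
- by rewrite /index_iota subnn big_nil mulmx0 add0r.
Qed.

(** Induction on time; the intercept is the trajectory with all residuals zero. The shift [o.1.+1]
    converts the ordinal index to a time. *)
Lemma state_affine w z t : (t < H)%N ->
  state G theta w z t.+1 = state G theta w (fun=> 0) t.+1 +
    \sum_(o : resid_idx H n) z o *: (pathway theta w o.1.+1 t *m delta_mx o.2 0).
Proof.
elim: t => [|t IHt] tH.
  rewrite /= !residE// -!addrA; congr (_ + _).
  rewrite [X in X + _]big1 ?add0r => [|o _]; last by rewrite if_same scale0r.
  apply: eq_bigr => o _; rewrite /pathway ltnS /=.
  case: (posnP o.1) => [->|o_gt0]; first by rewrite big_nil mul1mx.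
  by rewrite scale0r mul0mx scaler0.
have := IHt (ltnW tH).
set s := state _ _ _ z _; set r := state _ _ _ _ _ => sE.
pose M := step_mx theta w t.+1.
(* Substituting the policy closes the loop: one transition multiplies the deviation from the mean by
   [M]. *)
have stepE x : (beta_s w t.+1)^T *m (x - mu_s G t.+1) +
    (beta_a w t.+1)^T *m (policy G theta t.+1 x - mu_a G t.+1) =
    M *m (x - mu_s G t.+1).
  by rewrite /policy [mu_a _ _ + _]addrC addrK mulmxA -mulmxDl.
have stateE y : state G theta w y t.+2 = mu_s G t.+2 +
    M *m (state G theta w y t.+1 - mu_s G t.+1) + resid y t.+2.
  by rewrite -stepE addrA.
rewrite !stateE -/s -/r sE !residE// [X in _ = _ + X + _]big1 ?addr0; last first.
  by move=> o _; rewrite if_same scale0r.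
rewrite [r + _ - _]addrAC mulmxDr -!addrA; do 2!congr (_ + _).
rewrite mulmx_sumr -big_split; apply: eq_bigr => -[i l] _ /=.
(* The coefficient splits into the propagated effect and the newly injected residual. *)
rewrite pathwayS mulmxDl scalerDr -scalemxAr mulmxA; congr (_ + _).
by case: eqP => _; rewrite ?mul1mx// scale0r raddf0 mul0mx scaler0.
Qed.

Lemma cum_reward_affine w z : cum_reward G theta w z =
  cum_reward G theta w (fun=> 0) + \sum_(o : resid_idx H n)
    ((\sum_(0 <= t < H) ((rew_b G t.+1)^T *m (theta t.+1)^T + (rew_c G t.+1)^T)
      *m pathway theta w o.1.+1 t *m (delta_mx o.2 0 : 'cV[R]_n)) 0 0) * z o.
Proof.
pose row t := (rew_b G t.+1)^T *m (theta t.+1)^T + (rew_c G t.+1)^T.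
(* Under the linear policy the reward is affine in the state alone, with gradient [row t]. *)
have rewardD y v t : state G theta w y t.+1 = state G theta w (fun=> 0) t.+1 + v ->
    reward G theta w y t.+1 = reward G theta w (fun=> 0) t.+1 + (row t *m v) 0 0.
  rewrite /reward /action /policy => ->; rewrite [_ + v - _]addrAC.
  have addE (A B : 'M[R]_1) : (A + B) 0 0 = A 0 0 + B 0 0 by rewrite mxE.
  by rewrite /row mulmxDl !mulmxDr !mulmxA !addE; ring.
under eq_bigr do rewrite mulrC.
rewrite /cum_reward !big_mkord.
under [X in _ + X]eq_bigr do rewrite big_mkord summxE mulr_sumr.
rewrite exchange_big -big_split; apply: eq_bigr => t _ /=.
rewrite (rewardD _ _ _ (state_affine _ _ (ltn_ord t))); congr (_ + _).
rewrite mulmx_sumr summxE; apply: eq_bigr => o _.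
by rewrite -scalemxAr mxE mulmxA.
Qed.

End LinearModel.

(** * Value function and Shapley value of an affine output *)

Section PredictiveShapley.
Variables (R : realType) (n m H : nat).
Variables (dW dE : measure_display).
Variables (W : measurableType dW) (w : W -> params R n m H).
Variables (E : measurableType dE) (P : W -> probability E R).
Variable e : E -> resid_idx H n -> R.
Hypothesis e_gauss : forall x, centered_gaussian_vector (P x) e (cov_e (w x)).
Variable given : resid_idx H n -> R.
Variable Y : params R n m H -> (resid_idx H n -> R) -> R.
Variables (x : W) (b : R) (a : resid_idx H n -> R).
(** The affine form is asked only at the fixed [x], so [b] and [a] may depend on the parameters
    [w x]. *)
Hypothesis YE : forall z, Y (w x) z = b + \sum_o a o * z o.

Lemma value_fun_affine (U : {set resid_idx H n}) :
  value_fun w P e given Y x U = b + \sum_(o in U) a o * given o.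
Proof.
(* Only the factors left random keep their coefficient; those in [U] go into the constant. *)
pose c o := if o \in U then 0 else a o.
pose L y := \sum_o c o * e y o.
have [intL EL] := gaussian_combination_expectation c (e_gauss x).
rewrite /value_fun; set r := RHS.
rewrite (_ : (fun y => _) = cst r \+ L).
  rewrite expectationD; last 2 first.
  - by apply/Lfun1_integrable; exact: finite_measure_integrable_cst.
  - exact/Lfun1_integrable.
  by rewrite expectation_cst EL adde0.
apply/funext => y /=; rewrite YE /r -addrA; congr (_ + _).
rewrite [X in X + _]big_mkcond -big_split; apply: eq_bigr => o _ /=.
by rewrite /set_inputs /c; case: ifP => _; rewrite ?mul0r ?addr0 ?add0r.
Qed.

Lemma Sh_given_affine (o : resid_idx H n) :
  Sh_given w P e given Y o x = a o * given o.
Proof. exact: (shapley_additive _ value_fun_affine). Qed.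

End PredictiveShapley.

(** * Shapley values of the states and of the cumulative reward *)

Theorem theorem1 (R : realType) (n m H : nat)
    (n_ge1 : (1 <= n)%N) (m_ge1 : (1 <= m)%N) (H_ge1 : (1 <= H)%N)
    (G : pkg R n m) (theta : nat -> 'M[R]_(n, m))
    (dW : measure_display) (W : measurableType dW) (p : probability W R)
    (w : W -> params R n m H) (w_meas : measurable_params w)
    (dE : measure_display) (E : measurableType dE) (P : W -> probability E R)
    (e : E -> resid_idx H n -> R)
    (e_gauss : forall x : W, centered_gaussian_vector (P x) e (cov_e (w x)))
    (given : resid_idx H n -> R) (h : 'I_H) (k : 'I_n) :
  (forall t : nat, (0 <= t <= H - 1)%N ->
     (forall i, p.-integrable [set: W]
        (EFin \o Sh_given w P e given (state_comp G theta t.+1 i) (h, k))) ->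
     \col_i Sh p w P e given (state_comp G theta t.+1 i) (h, k) =
     expectation_vec p (fun x =>
       pathway theta (w x) h.+1 t *m (given (h, k) *: (delta_mx k 0 : 'cV[R]_n))))
  /\
  (p.-integrable [set: W]
     (EFin \o Sh_given w P e given (@cum_reward R n m H G theta) (h, k)) ->
   Sh p w P e given (@cum_reward R n m H G theta) (h, k) =
   ('E_p[fun x => ((\sum_(0 <= t < H)
      ((rew_b G t.+1)^T *m (theta t.+1)^T + (rew_c G t.+1)^T)
      *m pathway theta (w x) h.+1 t
      *m (given (h, k) *: (delta_mx k 0 : 'cV[R]_n))) 0 0)%R])%E).
Proof.
split=> [t /andP[_ tH] _|_].
  have {}tH : (t < H)%N by rewrite -(prednK H_ge1) ltnS -subn1.
  (* The two integrands agree at every parameter value [x], so the expectations coincide. *)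
  apply/colP => i; rewrite !mxE /Sh; congr expectation; apply/funext => x.
  rewrite (Sh_given_affine e_gauss given (Y := state_comp G theta t.+1 i)
    (b := state_comp G theta t.+1 i (w x) (fun=> 0))
    (a := fun o => (pathway theta (w x) o.1.+1 t *m delta_mx o.2 0 : 'cV[R]_n) i 0)).
    by rewrite -scalemxAr [RHS]mxE mulrC.
  move=> z; rewrite /state_comp state_affine// mxE summxE; congr (_ + _).
  by apply: eq_bigr => o _; rewrite mxE mulrC.
rewrite /Sh; congr expectation; apply/funext => x.
rewrite (Sh_given_affine e_gauss given (cum_reward_affine G theta (w x))).
rewrite mulrC !summxE mulr_sumr; apply: eq_bigr => t _.
by rewrite -scalemxAr [RHS]mxE.
Qed.
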